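(* Let $x,y:I\to\mathbb{R}$ be smooth functions on an open interval $I$ with $(x'(s))^2-(y'(s))^2=1$ and $\varepsilon_1\,(y(s)^2-x(s)^2)>0$ for all $s\in I$, where $\varepsilon_1\in\{1,-1\}$ is fixed. Let $M_1$ be the rotation surface in $\mathbb{E}_2^4$ given by $$\varphi(t,s)=\bigl(y(s)\sinh t,\;x(s)\cosh t,\;x(s)\sinh t,\;y(s)\cosh t\bigr),$$ and suppose that $M_1$ is flat. Then $M_1$ has pointwise 1-type Gauss map if and only if $M_1$ is either totally geodesic or parametrized by $$\varphi(t,s)=\left(\begin{array}{c} \frac12\varepsilon\left(\mu_2e^{(-b_0s+d)}-\mu_1e^{-(-b_0s+d)}\right)\sinh t,\\ \frac12\varepsilon\left(\mu_2e^{(-b_0s+d)}+\mu_1e^{-(-b_0s+d)}\right)\cosh t,\\ \frac12\varepsilon\left(\mu_2e^{(-b_0s+d)}+\mu_1e^{-(-b_0s+d)}\right)\sinh t,\\ \frac12\varepsilon\left(\mu_2e^{(-b_0s+d)}-\mu_1e^{-(-b_0s+d)}\right)\cosh t \end{array}\right),\qquad \mu_1\mu_2=-\frac{1}{b_0^2},$$ for some real constants $b_0\neq 0$, $\mu_1$, $\mu_2$, $d$ and some $\varepsilon\in\{1,-1\}$.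
   Context: $\mathbb{E}_2^4$ is $\mathbb{R}^4$ with the pseudo-Euclidean metric $g=dx_1^2+dx_2^2-dx_3^2-dx_4^2$. The surface is parametrized by $(t,s)\in\mathbb{R}\times I$ and carries the induced (non-degenerate) metric. It is flat if its Gaussian curvature vanishes identically, and totally geodesic if its second fundamental form vanishes identically. Gauss map: $\wedge^2\mathbb{E}_2^4$ is given the indefinite inner product $\langle u_1\wedge u_2,v_1\wedge v_2\rangle=\det(\langle u_i,v_j\rangle)$. The Gauss map is $G=e_1\wedge e_2:M\to\wedge^2\mathbb{E}_2^4$, where $e_1=\varphi_t/\sqrt{\varepsilon_1(y^2-x^2)}$ and $e_2=\varphi_s$ form an orthonormal tangent frame. Laplacian: for a smooth function $F$ on the surface, real-valued or with values in $\wedge^2\mathbb{E}_2^4$ (a fixed vector space, so $\Delta$ acts componentwise), $\Delta F=-\sum_i\epsilon_i\bigl(e_ie_iF-(\nabla_{e_i}e_i)F\bigr)$, where $\{e_i\}$ is a local orthonormal tangent frame, $\epsilon_i=\langle e_i,e_i\rangle=\pm1$, and $\nabla$ is the Levi-Civita connection of the induced metric. The surface has pointwise 1-type Gauss map if $\Delta G=f\,(G+C)$ for some smooth real function $f$ on the surface and some constant vector $C\in\wedge^2\mathbb{E}_2^4$. *)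

(* Defs.v *)
From Stdlib Require Import Reals.
From Coquelicot Require Import Coquelicot.

Local Open Scope R_scope.

Definition open_itv (a b : Rbar) (s : R) : Prop := Rbar_lt a s /\ Rbar_lt s b.

Definition smooth_on (I : R -> Prop) (x : R -> R) : Prop :=
  forall (n : nat) (s : R), I s -> ex_derive_n x n s.

(* [ex_diff_n f n t s]: all iterated partial derivatives of [f] up to order
   [n] exist and are jointly continuous at (t, s). *)
Definition smooth_on_strip (I : R -> Prop) (f : R -> R -> R) : Prop :=
  forall (n : nat) (t s : R), I s -> ex_diff_n f n t s.

Inductive axis : Set := X1 | X2 | X3 | X4.

Definition vec : Type := axis -> R.

Definition mkvec (a1 a2 a3 a4 : R) : vec :=
  fun k => match k with X1 => a1 | X2 => a2 | X3 => a3 | X4 => a4 end.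

(* The metric dx1^2 + dx2^2 - dx3^2 - dx4^2 of E_2^4. *)
Definition inner (u v : vec) : R :=
  u X1 * v X1 + u X2 * v X2 - u X3 * v X3 - u X4 * v X4.

(* Bivectors are given by their coordinates in the basis [d_i /\ d_j], i < j.
   The inner product of bivectors plays no role in the equation
   [Delta G = f (G + C)]. *)
Inductive axis2 : Set := X12 | X13 | X14 | X23 | X24 | X34.

Definition fst_axis (p : axis2) : axis :=
  match p with X12 | X13 | X14 => X1 | X23 | X24 => X2 | X34 => X3 end.

Definition snd_axis (p : axis2) : axis :=
  match p with X12 => X2 | X13 | X23 => X3 | X14 | X24 | X34 => X4 end.

Definition bivec : Type := axis2 -> R.

Definition wedge (u v : vec) : bivec :=
  fun p => u (fst_axis p) * v (snd_axis p) - u (snd_axis p) * v (fst_axis p).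

Inductive coord : Set := ct | cs.

Definition coord_sum (F : coord -> R) : R := F ct + F cs.

Definition scalar_field : Type := R -> R -> R.

(* A tangent vector field, by its components in the frame (d/dt, d/ds). *)
Definition vfield : Type := coord -> scalar_field.

Definition metric : Type := coord -> coord -> scalar_field.

Definition pd (c : coord) (F : scalar_field) : scalar_field :=
  match c with
  | ct => fun t s => Derive (fun u => F u s) t
  | cs => fun t s => Derive (fun v => F t v) s
  end.

Definition coord_field (c : coord) : vfield :=
  fun k _ _ => match c, k with ct, ct | cs, cs => 1 | _, _ => 0 end.

Definition dir (X : vfield) (F : scalar_field) : scalar_field :=
  fun t s => coord_sum (fun c => X c t s * pd c F t s).

Definition pairing (g : metric) (X Y : vfield) : scalar_field :=
  fun t s =>
    coord_sum (fun i => coord_sum (fun j => g i j t s * X i t s * Y j t s)).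

Definition detg (g : metric) : scalar_field :=
  fun t s => g ct ct t s * g cs cs t s - g ct cs t s * g cs ct t s.

Definition ginv (g : metric) : metric :=
  fun i j t s =>
    match i, j with
    | ct, ct => g cs cs t s / detg g t s
    | cs, cs => g ct ct t s / detg g t s
    | _, _ => - g i j t s / detg g t s
    end.

Definition christoffel (g : metric) (k i j : coord) : scalar_field :=
  fun t s =>
    / 2 * coord_sum (fun l =>
      ginv g k l t s *
      (pd i (g j l) t s + pd j (g i l) t s - pd l (g i j) t s)).

Definition nabla (g : metric) (X Y : vfield) : vfield :=
  fun k t s =>
    dir X (Y k) t s +
    coord_sum (fun i => coord_sum (fun j =>
      christoffel g k i j t s * X i t s * Y j t s)).

(* <R(d_t, d_s) d_s, d_t> / det g; the bracket [d_t, d_s] vanishes. *)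
Definition gauss_curvature (g : metric) : scalar_field :=
  fun t s =>
    let T := coord_field ct in
    let S := coord_field cs in
    let RTSS : vfield := fun k u v =>
      nabla g T (nabla g S S) k u v - nabla g S (nabla g T S) k u v in
    pairing g RTSS T t s / detg g t s.

(* (e1, e2) is meant to be an orthonormal frame, for the metric g; the value
   does not depend on which one. *)
Definition laplacian (g : metric) (e1 e2 : vfield) (F : scalar_field) :
    scalar_field :=
  fun t s =>
    - (pairing g e1 e1 t s *
         (dir e1 (dir e1 F) t s - dir (nabla g e1 e1) F t s) +
       pairing g e2 e2 t s *
         (dir e2 (dir e2 F) t s - dir (nabla g e2 e2) F t s)).

Definition surface : Type := R -> R -> vec.

(* The tangent vector of E_2^4 represented by X. *)
Definition push (phi : surface) (X : vfield) : surface :=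
  fun t s k => dir X (fun u v => phi u v k) t s.

Definition induced_metric (phi : surface) : metric :=
  fun i j t s =>
    inner (push phi (coord_field i) t s) (push phi (coord_field j) t s).

Definition flat (I : R -> Prop) (phi : surface) : Prop :=
  forall t s, I s -> gauss_curvature (induced_metric phi) t s = 0.

(* Gauss formula: the ambient derivative of Y along X is the sum of the
   Levi-Civita derivative and of the second fundamental form. *)
Definition second_fundamental_form (phi : surface) (X Y : vfield) : surface :=
  fun t s k =>
    dir X (fun u v => push phi Y u v k) t s -
    push phi (nabla (induced_metric phi) X Y) t s k.

Definition totally_geodesic (I : R -> Prop) (phi : surface) : Prop :=
  forall (i j : coord) (t s : R), I s -> forall k : axis,
    second_fundamental_form phi (coord_field i) (coord_field j) t s k = 0.

Definition gauss_map (phi : surface) (e1 e2 : vfield) (t s : R) : bivec :=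
  wedge (push phi e1 t s) (push phi e2 t s).

Definition pointwise_1_type_gauss_map (I : R -> Prop) (phi : surface)
    (e1 e2 : vfield) : Prop :=
  exists (f : scalar_field) (C : bivec),
    smooth_on_strip I f /\
    forall (t s : R), I s -> forall p : axis2,
      laplacian (induced_metric phi) e1 e2
        (fun u v => gauss_map phi e1 e2 u v p) t s =
      f t s * (gauss_map phi e1 e2 t s p + C p).

Definition rotation_surface (x y : R -> R) : surface :=
  fun t s =>
    mkvec (y s * sinh t) (x s * cosh t) (x s * sinh t) (y s * cosh t).

(* On the rotation surface <phi_t, phi_t> = y^2 - x^2, <phi_t, phi_s> = 0 and
   <phi_s, phi_s> = x'^2 - y'^2, so this and phi_s are orthonormal. *)
Definition rotation_e1 (eps1 : R) (x y : R -> R) : vfield :=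
  fun k t s =>
    match k with
    | ct => / sqrt (eps1 * (y s ^ 2 - x s ^ 2))
    | cs => 0
    end.

Definition rotation_e2 : vfield := coord_field cs.

(* Main.v *)
Require Import Defs.
From Stdlib Require Import Reals Lra Psatz.
From Coquelicot Require Import Coquelicot.
Open Scope R_scope.

(** The induced metric is [eps1 r^2 dt^2 + ds^2] with [r^2 = eps1 (y^2 - x^2)], and its
    curvature is [- r'' / r], so flatness means [r = lam s + c]. Together with unit speed,
    this turns the profile curve into a spiral: for a constant [k] with
    [k^2 = lam^2 + eps1],
      [r x' = lam x + k y]  and  [r y' = lam y + k x]
    ([flat_rotation_spiral]). In particular the null coordinates [(x + y) / r] and
    [(x - y) / r] are multiplied by [k] and [- k] under the operator [r d/ds].

    The components of the Gauss map then split as a multiple of [eps1 k] times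
    [cosh (2 t)] or [sinh (2 t)], plus a combination of the squares [Q] and [N] of the two
    null coordinates, plus a constant ([spiral_gauss_map]). The flat Laplacian acts on the
    first part by the factor [- 4 eps1 / r^2] and on the second by [- 4 k^2 / r^2]
    ([spiral_laplacian_gauss_map]).

    If [k = 0], the Gauss map is harmonic, and this is exactly the totally geodesic case
    ([spiral_totally_geodesic]). If [k <> 0], the t-dependent part leaves no choice but
    [f = - 4 eps1 / r^2] at [t = 1], and the s-dependent part, which is not constant,
    requires the same factor, so [k^2 = eps1] and [lam = 0] ([spiral_1_type_rigid]). With
    [lam = 0] we have [eps1 = 1] and [k = 1] or [k = -1], the null coordinates of the profile
    are exponentials, and this is the explicit family ([spiral_lam_0_exp],
    [spiral_exp_lam_0]); conversely its Gauss map satisfies [Delta G = - (4 / c^2) G]. *)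

(** * Calculus on an open interval *)

Lemma open_itv_open (a b : Rbar) : open (open_itv a b).
Proof. apply open_and; [apply open_Rbar_gt | apply open_Rbar_lt]. Qed.

(** A second point serves to conclude [lam = 0] when [lam * s + c] is constant on the
    interval. *)
Lemma open_itv_two_points (a b : Rbar) : Rbar_lt a b ->
  exists s1 s2, open_itv a b s1 /\ open_itv a b s2 /\ s1 < s2.
Proof.
  intros hab.
  assert (H : exists s, open_itv a b s).
  { destruct a as [a| |], b as [b| |]; simpl in hab; try easy.
    - exists ((a + b) / 2); split; simpl; lra.
    - exists (a + 1); split; simpl; lra || easy.
    - exists (b - 1); split; simpl; lra || easy.
    - exists 0; split; simpl; easy. }
  destruct H as [s hs].
  destruct (open_itv_open a b s hs) as [e he].
  assert (he0 := cond_pos e).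
  exists s, (s + e / 2); repeat split; try apply hs; try lra.
  all: apply he; unfold ball; simpl; unfold AbsRing_ball, abs, minus, plus, opp; simpl;
    rewrite Rabs_pos_eq; lra.
Qed.

Lemma const_of_derive_zero (a b : Rbar) (F : R -> R) :
  (forall s, open_itv a b s -> is_derive F s 0) ->
  forall s1 s2, open_itv a b s1 -> open_itv a b s2 -> F s1 = F s2.
Proof.
  intros hF.
  assert (H : forall s1 s2, open_itv a b s1 -> open_itv a b s2 -> s1 < s2 -> F s1 = F s2).
  { intros s1 s2 [h1 _] [_ h2] h12. apply eq_is_derive; [|exact h12].
    intros s hs. apply hF; split.
    - apply Rbar_lt_le_trans with s1; simpl; [exact h1 | lra].
    - apply Rbar_le_lt_trans with s2; simpl; [lra | exact h2]. }
  intros s1 s2 h1 h2.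
  destruct (Rtotal_order s1 s2) as [h | [-> | h]]; auto.
  symmetry; auto.
Qed.

Lemma is_derive_eq (F : R -> R) (s l l' : R) :
  is_derive F s l -> l = l' -> is_derive F s l'.
Proof. intros h <-; exact h. Qed.

Lemma is_derive_cst (c s : R) : is_derive (fun _ => c) s 0.
Proof. exact (is_derive_const c s). Qed.

Lemma is_derive_ext_on (I : R -> Prop) (F G : R -> R) (s l : R) : open I -> I s ->
  (forall v, I v -> F v = G v) -> is_derive G s l -> is_derive F s l.
Proof.
  intros hI hs hFG. apply is_derive_ext_loc.
  apply (filter_imp I); [intros v hv; symmetry; auto | apply hI, hs].
Qed.

(** Linear independence of [F] and the constants, seen on the derivative at one point. *)
Lemma const_multiple_zero (I : R -> Prop) (F : R -> R) (s l A : R) : open I -> I s ->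
  is_derive F s l -> l <> 0 -> (forall v, I v -> A * F v = A * F s) -> A = 0.
Proof.
  intros hI hs hF hl hA.
  assert (h : is_derive (fun v => A * F v) s 0).
  { apply is_derive_ext_on with I (fun _ => A * F s); auto using is_derive_cst. }
  apply is_derive_unique in h. rewrite Derive_scal, (is_derive_unique _ _ _ hF) in h.
  apply Rmult_integral in h. destruct h as [h | h]; [exact h | contradiction].
Qed.

Lemma pd_ct_eq (F : scalar_field) (G : R -> R) (t s l : R) :
  (forall u, F u s = G u) -> is_derive G t l -> pd ct F t s = l.
Proof.
  intros hFG hG. apply is_derive_unique.
  apply is_derive_ext with G; [intros u; symmetry; apply hFG | exact hG].
Qed.

(** The functions to be differentiated, such as the components of a metric or of the
    Gauss map, have a closed form only over the interval where the profile curve is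
    controlled, so their s-derivatives are computed by locality. *)
Lemma pd_cs_eq (I : R -> Prop) (F : scalar_field) (G : R -> R) (t s l : R) :
  open I -> I s -> (forall v, I v -> F t v = G v) -> is_derive G s l -> pd cs F t s = l.
Proof.
  intros hI hs hFG hG. apply is_derive_unique.
  apply is_derive_ext_on with I G; auto.
Qed.

Lemma is_derive_cosh (t : R) : is_derive cosh t (sinh t).
Proof. apply is_derive_Reals, derivable_pt_lim_cosh. Qed.

Lemma is_derive_sinh (t : R) : is_derive sinh t (cosh t).
Proof. apply is_derive_Reals, derivable_pt_lim_sinh. Qed.

Lemma cosh2_sinh2 (t : R) : cosh t ^ 2 = 1 + sinh t ^ 2.
Proof.
  unfold cosh, sinh.
  assert (H : exp t * exp (- t) = 1) by (rewrite <- exp_plus, Rplus_opp_r; apply exp_0).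
  nra.
Qed.

(** * Metrics invariant under translations in t *)

(** The metric [W dt^2 + ds^2]. Recording the logarithmic derivative [h = W' / (2 W)]
    instead of [W'] makes everything below polynomial in [h]: the speed [r] of the
    orbits satisfies [r' = h r], the curvature is [- (h' + h^2)], and [h] is the
    coefficient of the first-order term of the Laplacian. *)
Definition warped (I : R -> Prop) (W h : R -> R) (g : metric) : Prop :=
  open I /\
  (forall s, I s -> W s <> 0) /\
  (forall s, I s -> is_derive W s (2 * h s * W s)) /\
  forall t s, I s ->
    g ct ct t s = W s /\ g ct cs t s = 0 /\ g cs ct t s = 0 /\ g cs cs t s = 1.

Definition warped_gamma (W h : R -> R) (k i j : coord) (s : R) : R :=
  match k, i, j with
  | ct, ct, cs | ct, cs, ct => h s
  | cs, ct, ct => - (h s * W s)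
  | _, _, _ => 0
  end.

Lemma warped_pd (I : R -> Prop) (W h : R -> R) (g : metric) : warped I W h g ->
  forall i j l t s, I s ->
  pd i (g j l) t s =
    match i, j, l with cs, ct, ct => 2 * h s * W s | _, _, _ => 0 end.
Proof.
  intros (hI & _ & hW & hg) i j l t s hs.
  destruct i.
  - replace (match j, l with ct, ct => _ | _, _ => _ end) with 0 by now destruct j, l.
    apply pd_ct_eq with (fun _ => g j l t s); [|apply is_derive_cst].
    intros u. destruct (hg u s hs) as (h1 & h2 & h3 & h4), (hg t s hs) as (k1 & k2 & k3 & k4).
    destruct j, l; congruence.
  - apply (pd_cs_eq I) with
      (fun v => match j, l with ct, ct => W v | cs, cs => 1 | _, _ => 0 end); [exact hI | exact hs | |].
    + intros v hv. destruct (hg t v hv) as (h1 & h2 & h3 & h4). destruct j, l; assumption.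
    + destruct j, l; [exact (hW s hs) | apply is_derive_cst ..].
Qed.

Lemma warped_christoffel (I : R -> Prop) (W h : R -> R) (g : metric) : warped I W h g ->
  forall k i j t s, I s -> christoffel g k i j t s = warped_gamma W h k i j s.
Proof.
  intros hw k i j t s hs. unfold christoffel, coord_sum.
  rewrite !(warped_pd I W h g hw) by exact hs.
  destruct hw as (hI & hW0 & hW & hg).
  destruct (hg t s hs) as (h1 & h2 & h3 & h4). specialize (hW0 s hs).
  unfold ginv, detg.
  destruct k, i, j; simpl; rewrite ?h1, ?h2, ?h3, ?h4; field; lra.
Qed.

Lemma pd_const_field (i : coord) (a t s : R) : pd i (fun _ _ => a) t s = 0.
Proof. destruct i; exact (Derive_const a _). Qed.

Lemma nabla_coord (I : R -> Prop) (W h : R -> R) (g : metric) : warped I W h g ->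
  forall i j k t s, I s ->
  nabla g (coord_field i) (coord_field j) k t s = warped_gamma W h k i j s.
Proof.
  intros hw i j k t s hs. unfold nabla, dir, coord_sum.
  assert (H : forall i', pd i' (coord_field j k) t s = 0).
  { intros i'. destruct j, k; apply pd_const_field. }
  rewrite !H, !(warped_christoffel I W h g hw) by exact hs.
  destruct i, j, k; simpl; ring.
Qed.

(** From [nabla_S S = 0] and [nabla_T S = h T] we get
    [R(T, S) S = - nabla_S (h T) = - (h' + h^2) T]. *)
Lemma warped_gauss_curvature (I : R -> Prop) (W h : R -> R) (g : metric) :
  warped I W h g -> forall t s h1, I s -> is_derive h s h1 ->
  gauss_curvature g t s = - (h1 + h s ^ 2).
Proof.
  intros hw t s h1 hs hh.
  assert (hN := fun i j k t s => nabla_coord I W h g hw i j k t s).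
  destruct (hw) as (hI & hW0 & hW & hg).
  destruct (hg t s hs) as (g1 & g2 & g3 & g4). specialize (hW0 s hs).
  unfold gauss_curvature, pairing, coord_sum, detg.
  rewrite g1, g2, g3, g4.
  cbv zeta.
  assert (H1 : nabla g (coord_field ct) (nabla g (coord_field cs) (coord_field cs)) ct t s = 0).
  { unfold nabla at 1, dir, coord_sum.
    rewrite !(warped_christoffel I W h g hw), !hN by exact hs.
    rewrite (pd_ct_eq _ (fun _ => 0) t s 0); [simpl; ring | | apply is_derive_cst].
    intros u. apply hN, hs. }
  assert (H2 : nabla g (coord_field cs) (nabla g (coord_field ct) (coord_field cs)) ct t s = h1 + h s ^ 2).
  { unfold nabla at 1, dir, coord_sum.
    rewrite !(warped_christoffel I W h g hw), !hN by exact hs.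
    rewrite (pd_cs_eq I _ h t s h1 hI hs); [simpl; ring | | exact hh].
    intros v hv. apply hN, hv. }
  rewrite H1, H2. simpl. field. exact hW0.
Qed.

(** Here [r] is the speed of the orbits of the rotation, [W = eps r^2]. The frame
    derivatives of a function [al * E t + B s] separate, and the only correction comes
    from [nabla_{e1} e1 = - (h W / r^2) d/ds], which carries the sign [eps] twice. *)
Lemma warped_laplacian (I : R -> Prop) (eps : R) (W h r : R -> R) (g : metric)
    (e1 : vfield) (F : scalar_field) (E E1 B B1 : R -> R) (al E2 B2 t s : R) :
  warped I W h g -> (forall v, I v -> W v = eps * r v ^ 2) -> eps ^ 2 = 1 -> I s ->
  (forall v, I v -> r v <> 0) ->
  (forall u v, I v -> e1 ct u v = / r v) -> (forall u v, e1 cs u v = 0) ->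
  (forall u v, I v -> F u v = al * E u + B v) ->
  (forall u, is_derive E u (E1 u)) -> is_derive E1 t E2 ->
  (forall v, I v -> is_derive B v (B1 v)) -> is_derive B1 s B2 ->
  laplacian g e1 rotation_e2 F t s = - (eps * al * E2 / r s ^ 2 + h s * B1 s + B2).
Proof.
  intros hw hWr heps hs hr he1 he1' hF hE hE1 hB hB1.
  destruct (hw) as (hI & hW0 & hW & hg).
  destruct (hg t s hs) as (g1 & g2 & g3 & g4).
  assert (hr' := hr s hs).
  assert (hFt : forall u v, I v -> pd ct F u v = al * E1 u).
  { intros u v hv. apply pd_ct_eq with (fun u => al * E u + B v); [auto|].
    apply is_derive_eq with (al * E1 u + 0); [|ring].
    apply (is_derive_plus (fun u => al * E u)); [apply is_derive_scal, hE | apply is_derive_cst]. }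
  assert (hFs : forall u v, I v -> pd cs F u v = B1 v).
  { intros u v hv. apply pd_cs_eq with I (fun v => al * E u + B v); auto.
    apply is_derive_eq with (0 + B1 v); [|ring].
    apply (is_derive_plus (fun v => al * E u)); [apply is_derive_cst | auto]. }
  assert (hd1 : forall u, dir e1 F u s = al * E1 u / r s).
  { intros u. unfold dir, coord_sum. rewrite he1, he1', hFt by exact hs. field; exact hr'. }
  assert (hd2 : forall v, I v -> dir rotation_e2 F t v = B1 v).
  { intros v hv. unfold dir, coord_sum. rewrite hFs by exact hv. unfold rotation_e2; simpl. ring. }
  assert (hdd1 : dir e1 (dir e1 F) t s = al * E2 / r s ^ 2).
  { unfold dir at 1, coord_sum. rewrite he1, he1' by exact hs.
    rewrite (pd_ct_eq _ (fun u => al * E1 u / r s) t s (al * E2 / r s)).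
    - field; exact hr'.
    - exact hd1.
    - apply is_derive_eq with (/ r s * (al * E2)); [|field; exact hr'].
      apply is_derive_ext with (fun u => / r s * (al * E1 u)).
      + intros u. apply Rmult_comm.
      + apply is_derive_scal, is_derive_scal, hE1. }
  assert (hdd2 : dir rotation_e2 (dir rotation_e2 F) t s = B2).
  { unfold dir at 1, coord_sum.
    rewrite (pd_cs_eq I (dir rotation_e2 F) B1 t s B2); auto. unfold rotation_e2; simpl. ring. }
  assert (hn2 : dir (nabla g rotation_e2 rotation_e2) F t s = 0).
  { unfold dir, coord_sum, rotation_e2. rewrite !(nabla_coord I W h g hw) by exact hs.
    simpl; ring. }
  assert (hn1 : dir (nabla g e1 e1) F t s = - (h s * W s / r s ^ 2) * B1 s).
  { unfold dir, coord_sum. rewrite hFs by exact hs.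
    unfold nabla, dir, coord_sum.
    rewrite !(warped_christoffel I W h g hw) by exact hs.
    rewrite !he1, !he1' by exact hs.
    rewrite (pd_ct_eq (e1 ct) (fun _ => / r s) t s 0); [| intros u; auto | apply is_derive_cst].
    rewrite (pd_ct_eq (e1 cs) (fun _ => 0) t s 0); [| intros u; auto | apply is_derive_cst].
    simpl. field; exact hr'. }
  unfold laplacian. rewrite hdd1, hdd2, hn1, hn2.
  unfold pairing, coord_sum. rewrite g1, g2, g3, g4, he1, he1' by exact hs.
  unfold rotation_e2; simpl. rewrite (hWr s hs).
  replace (1 / 1) with 1 by field.
  transitivity (- (eps * al * E2 / r s ^ 2 + eps ^ 2 * h s * B1 s + B2)); [field; exact hr'|].
  rewrite heps; field; exact hr'.
Qed.

(** * Flat rotation surfaces have spiral profiles *)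

(** [auto_derive] leaves the derivatives of unknown functions as [Derive] terms,
    eta-expanded; these two tactics replace them by the values given by hypotheses. *)
Ltac use_derive h :=
  match type of h with
  | is_derive ?f ?s ?l =>
      try replace (Derive (fun z => f z) s) with l by (symmetry; exact (is_derive_unique f s l h))
  end.

Ltac derive_with hx hy :=
  auto_derive;
  [ repeat split; try (eexists; first [exact hx | exact hy]); try assumption
  | use_derive hx; use_derive hy ].

Lemma push_rotation_ct (x y : R -> R) (t s : R) (k : axis) :
  push (rotation_surface x y) (coord_field ct) t s k =
  mkvec (y s * cosh t) (x s * sinh t) (x s * cosh t) (y s * sinh t) k.
Proof.
  unfold push, dir, coord_sum; simpl.
  assert (hS := is_derive_scal sinh t). assert (hC := is_derive_scal cosh t).
  destruct k; simpl.
  - rewrite (is_derive_unique _ _ _ (hS (y s) _ (is_derive_sinh t))); ring.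
  - rewrite (is_derive_unique _ _ _ (hC (x s) _ (is_derive_cosh t))); ring.
  - rewrite (is_derive_unique _ _ _ (hS (x s) _ (is_derive_sinh t))); ring.
  - rewrite (is_derive_unique _ _ _ (hC (y s) _ (is_derive_cosh t))); ring.
Qed.

Lemma push_rotation_cs (x y : R -> R) (t s x1 y1 : R) (k : axis) :
  is_derive x s x1 -> is_derive y s y1 ->
  push (rotation_surface x y) (coord_field cs) t s k =
  mkvec (y1 * sinh t) (x1 * cosh t) (x1 * sinh t) (y1 * cosh t) k.
Proof.
  intros hx hy. unfold push, dir, coord_sum; simpl.
  destruct k; simpl; rewrite Derive_scal_l;
    rewrite ?(is_derive_unique _ _ _ hx), ?(is_derive_unique _ _ _ hy); ring.
Qed.

Lemma rotation_warped (I : R -> Prop) (x y x1 y1 h : R -> R) : open I ->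
  (forall s, I s -> is_derive x s (x1 s)) -> (forall s, I s -> is_derive y s (y1 s)) ->
  (forall s, I s -> x1 s ^ 2 - y1 s ^ 2 = 1) ->
  (forall s, I s -> y s ^ 2 - x s ^ 2 <> 0) ->
  (forall s, I s -> h s * (y s ^ 2 - x s ^ 2) = y s * y1 s - x s * x1 s) ->
  warped I (fun s => y s ^ 2 - x s ^ 2) h (induced_metric (rotation_surface x y)).
Proof.
  intros hI hx hy hu hW hh. split; [exact hI|]. split; [exact hW|]. split.
  - intros s hs. assert (hxs := hx s hs). assert (hys := hy s hs).
    rewrite Rmult_assoc, hh by exact hs. derive_with hxs hys. ring.
  - intros t s hs. specialize (hu s hs).
    unfold induced_metric, inner.
    rewrite !push_rotation_ct, !(push_rotation_cs x y t s (x1 s) (y1 s)) by auto.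
    simpl. assert (hC := cosh2_sinh2 t).
    repeat split; try ring [hC].
    ring_simplify. rewrite hC. ring_simplify. lra.
Qed.

(** The profile curves of flat rotation surfaces. With [r = lam s + c], the null
    coordinates [p = x + y] and [m = x - y] satisfy [r p' = (lam + k) p] and
    [r m' = (lam - k) m]: the curve is a Lorentzian logarithmic spiral, a hyperbola
    when [lam = 0] and a half-line when [k = 0]. Unit speed amounts to the last field. *)
Record spiral_profile (I : R -> Prop) (eps lam c k : R) (x y : R -> R) : Prop := {
  spiral_open : open I;
  spiral_eps : eps ^ 2 = 1;
  spiral_pos : forall s, I s -> 0 < lam * s + c;
  spiral_norm : forall s, I s -> y s ^ 2 - x s ^ 2 = eps * (lam * s + c) ^ 2;
  spiral_dx : forall s, I s -> is_derive x s ((lam * x s + k * y s) / (lam * s + c));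
  spiral_dy : forall s, I s -> is_derive y s ((lam * y s + k * x s) / (lam * s + c));
  spiral_k : k ^ 2 = lam ^ 2 + eps }.

(** Flatness is [h' = - h^2], so that [r' = h r] is a constant [lam]. This gives the
    inner product [y y' - x x' = eps lam r]; the cross product [y x' - x y' = A r] is then
    determined up to sign, because Lagrange's identity and unit speed yield
    [A^2 = lam^2 + eps]. So [A] is constant as well, and solving the two linear equations
    for [x'] and [y'] gives the spiral, with [k = eps A]. *)
Lemma flat_rotation_spiral (a b : Rbar) (eps : R) (x y : R -> R) :
  Rbar_lt a b -> eps ^ 2 = 1 ->
  smooth_on (open_itv a b) x -> smooth_on (open_itv a b) y ->
  (forall s, open_itv a b s -> Derive x s ^ 2 - Derive y s ^ 2 = 1) ->
  (forall s, open_itv a b s -> eps * (y s ^ 2 - x s ^ 2) > 0) ->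
  flat (open_itv a b) (rotation_surface x y) ->
  exists lam c k, spiral_profile (open_itv a b) eps lam c k x y.
Proof.
  intros hab heps sx sy hu hpos hflat.
  set (I := open_itv a b) in *.
  assert (hI : open I) by apply open_itv_open.
  assert (hx : forall s, I s -> is_derive x s (Derive x s)).
  { intros s hs. apply Derive_correct, (sx 1%nat s hs). }
  assert (hy : forall s, I s -> is_derive y s (Derive y s)).
  { intros s hs. apply Derive_correct, (sy 1%nat s hs). }
  assert (hx2 : forall s, I s -> is_derive (Derive x) s (Derive (Derive x) s)).
  { intros s hs. apply Derive_correct, (sx 2%nat s hs). }
  assert (hy2 : forall s, I s -> is_derive (Derive y) s (Derive (Derive y) s)).
  { intros s hs. apply Derive_correct, (sy 2%nat s hs). }
  set (x1 := Derive x) in *. set (y1 := Derive y) in *.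
  set (W := fun s => y s ^ 2 - x s ^ 2).
  set (h := fun s => (y s * y1 s - x s * x1 s) / W s).
  assert (hW : forall s, I s -> W s <> 0).
  { intros s hs h0. specialize (hpos s hs). unfold W in h0. rewrite h0 in hpos. lra. }
  assert (hw : warped I W h (induced_metric (rotation_surface x y))).
  { apply rotation_warped with x1 y1; auto.
    intros s hs. unfold h. fold (W s). field. auto. }
  assert (hh : forall s, I s -> is_derive h s (- h s ^ 2)).
  { intros s hs.
    assert (ex : ex_derive h s).
    { unfold h, W. auto_derive.
      assert (hWs := hW s hs). repeat split; auto; eexists; eauto. }
    assert (hd := Derive_correct h s ex).
    assert (hK := warped_gauss_curvature I W h _ hw 0 s _ hs hd).
    rewrite (hflat 0 s hs) in hK.
    apply is_derive_eq with (Derive h s); [exact hd | lra]. }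
  set (r := fun s => sqrt (eps * W s)).
  assert (hr0 : forall s, I s -> 0 < r s) by (intros s hs; apply sqrt_lt_R0, hpos, hs).
  assert (hr2 : forall s, I s -> W s = eps * r s ^ 2).
  { intros s hs. unfold r. rewrite pow2_sqrt by (apply Rlt_le, hpos, hs).
    rewrite <- Rmult_assoc. replace (eps * eps) with (eps ^ 2) by ring. rewrite heps; ring. }
  assert (hr : forall s, I s -> is_derive r s (h s * r s)).
  { intros s hs. assert (hWs := proj1 (proj2 (proj2 hw)) s hs).
    assert (h0 := hr0 s hs).
    unfold r. auto_derive.
    - repeat split; [eexists; exact hWs | apply hpos, hs].
    - use_derive hWs. fold (r s).
      rewrite (hr2 s hs).
      transitivity (eps ^ 2 * (h s * r s)); [field | rewrite heps; ring].
      apply Rgt_not_eq, h0. }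
  destruct (open_itv_two_points a b hab) as (s0 & _ & hs0 & _).
  set (lam := h s0 * r s0).
  assert (hlam : forall s, I s -> h s * r s = lam).
  { intros s hs. apply (const_of_derive_zero a b (fun s => h s * r s)); auto.
    intros v hv. assert (h1 := hh v hv). assert (h2 := hr v hv).
    derive_with h1 h2. ring. }
  set (c := r s0 - lam * s0).
  assert (hrl : forall s, I s -> r s = lam * s + c).
  { intros s hs.
    enough (r s - lam * s = r s0 - lam * s0) by (unfold c; lra).
    apply (const_of_derive_zero a b (fun s => r s - lam * s)); auto.
    intros v hv. assert (h2 := hr v hv).
    derive_with h2 h2. rewrite (hlam v hv). ring. }
  set (A := fun s => (y s * x1 s - x s * y1 s) / r s).
  assert (hyx : forall s, I s -> y s * y1 s - x s * x1 s = eps * lam * r s).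
  { intros s hs. transitivity (h s * W s); [unfold h; field; auto|].
    rewrite (hr2 s hs), <- (hlam s hs). ring. }
  assert (hA2 : forall s, I s -> A s ^ 2 = lam ^ 2 + eps).
  { intros s hs. unfold A. assert (h0 := hr0 s hs).
    assert (h1 := hyx s hs). assert (h2 := hu s hs). assert (h3 := hr2 s hs).
    unfold W in h3.
    assert (h4 : (y s * x1 s - x s * y1 s) ^ 2 =
      (y s * y1 s - x s * x1 s) ^ 2 + (y s ^ 2 - x s ^ 2) * (x1 s ^ 2 - y1 s ^ 2)) by ring.
    rewrite h1, h2, h3 in h4.
    transitivity ((y s * x1 s - x s * y1 s) ^ 2 / r s ^ 2); [field; lra|].
    rewrite h4. transitivity (eps ^ 2 * lam ^ 2 + eps); [field; lra | rewrite heps; ring]. }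
  (* The square of A being constant, A is locally constant: its derivative is 0 both where
     A vanishes, as A then vanishes everywhere, and where 2 A A' = 0 can be divided by A. *)
  assert (hA : forall s, I s -> A s = A s0).
  { intros s hs. apply (const_of_derive_zero a b A); auto.
    intros v hv.
    destruct (Req_dec (A v) 0) as [hz | hz].
    - apply is_derive_ext_on with I (fun _ => 0); auto using is_derive_cst.
      intros w hw'. assert (h1 := hA2 v hv). rewrite <- (hA2 w hw') in h1. nra.
    - assert (ex : ex_derive A v).
      { unfold A. auto_derive. assert (h0 := hr0 v hv).
        repeat split; try (eexists; eauto); lra. }
      assert (hd := Derive_correct A v ex).
      assert (hd2 : is_derive (fun s => A s ^ 2) v 0).
      { apply is_derive_ext_on with I (fun _ => lam ^ 2 + eps); auto using is_derive_cst. }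
      assert (hd3 : is_derive (fun s => A s ^ 2) v (2 * A v * Derive A v)).
      { derive_with hd hd. ring. }
      apply is_derive_unique in hd2. apply is_derive_unique in hd3.
      rewrite hd2 in hd3.
      apply is_derive_eq with (Derive A v); [exact hd | nra]. }
  exists lam, c, (eps * A s0).
  assert (hAk : forall s, I s -> y s * x1 s - x s * y1 s = A s0 * r s).
  { intros s hs. rewrite <- (hA s hs). unfold A. field. apply Rgt_not_eq, hr0, hs. }
  constructor; auto.
  - intros s hs. rewrite <- hrl by exact hs. auto.
  - intros s hs. rewrite <- hrl by exact hs. apply hr2, hs.
  - intros s hs. apply is_derive_eq with (x1 s); [auto|].
    rewrite <- hrl by exact hs.
    assert (h0 := hr0 s hs). assert (h1 := hyx s hs). assert (h2 := hAk s hs).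
    assert (h3 := hr2 s hs). unfold W in h3.
    apply Rmult_eq_reg_r with (r s ^ 2); [|nra].
    transitivity (eps * x1 s * (y s ^ 2 - x s ^ 2)); [rewrite h3; ring [heps]|].
    transitivity (eps * (y s * (y s * x1 s - x s * y1 s) + x s * (y s * y1 s - x s * x1 s)));
      [ring|].
    rewrite h1, h2. transitivity ((eps ^ 2 * lam * x s + eps * A s0 * y s) * r s); [ring|].
    rewrite heps. field. lra.
  - intros s hs. apply is_derive_eq with (y1 s); [auto|].
    rewrite <- hrl by exact hs.
    assert (h0 := hr0 s hs). assert (h1 := hyx s hs). assert (h2 := hAk s hs).
    assert (h3 := hr2 s hs). unfold W in h3.
    apply Rmult_eq_reg_r with (r s ^ 2); [|nra].
    transitivity (eps * y1 s * (y s ^ 2 - x s ^ 2)); [rewrite h3; ring [heps]|].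
    transitivity (eps * (x s * (y s * x1 s - x s * y1 s) + y s * (y s * y1 s - x s * x1 s)));
      [ring|].
    rewrite h1, h2. transitivity ((eps ^ 2 * lam * y s + eps * A s0 * x s) * r s); [ring|].
    rewrite heps. field. lra.
  - rewrite <- (hA2 s0 hs0). rewrite Rpow_mult_distr, heps. ring.
Qed.

Lemma spiral_warped (I : R -> Prop) (eps lam c k : R) (x y : R -> R) :
  spiral_profile I eps lam c k x y ->
  warped I (fun s => y s ^ 2 - x s ^ 2) (fun s => lam / (lam * s + c))
    (induced_metric (rotation_surface x y)).
Proof.
  intros [hI heps hpos hn hx hy hk].
  apply rotation_warped with (fun s => (lam * x s + k * y s) / (lam * s + c))
    (fun s => (lam * y s + k * x s) / (lam * s + c)); auto.
  - intros s hs. assert (h0 := hpos s hs). assert (h1 := hn s hs).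
    transitivity ((k ^ 2 - lam ^ 2) * (y s ^ 2 - x s ^ 2) / (lam * s + c) ^ 2); [field; lra|].
    rewrite h1, hk. transitivity (eps ^ 2); [field; lra | exact heps].
  - intros s hs. assert (h0 := hpos s hs). rewrite hn by exact hs.
    intros h1. assert (h2 : eps <> 0) by nra.
    apply (Rmult_integral_contrapositive_currified _ _ h2 (pow_nonzero _ 2 (Rgt_not_eq _ _ h0)) h1).
  - intros s hs. assert (h0 := hpos s hs). field. lra.
Qed.

(** * The Gauss map of a spiral surface and its Laplacian *)

(** In coordinates, each component of the Gauss map of a spiral surface is
    [gauss_t_coef * gauss_t t + plus_coef * Q s + minus_coef * N s + const_coef] where
    [Q = ((x + y) / r)^2] and [N = ((x - y) / r)^2] are the squares of the null
    coordinates of [(x, y) / r]. The function [gauss_t] is [cosh (2 t)] or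
    [sinh (2 t) / 2]. *)
Definition gauss_t (p : axis2) (t : R) : R :=
  match p with
  | X12 | X34 => cosh t ^ 2 + sinh t ^ 2
  | _ => sinh t * cosh t
  end.

Definition gauss_t_coef (eps k : R) (p : axis2) : R :=
  match p with
  | X12 => eps * k / 2 | X34 => - (eps * k / 2)
  | X13 => eps * k | X24 => - (eps * k)
  | _ => 0
  end.

Definition plus_coef (lam k : R) (p : axis2) : R :=
  match p with
  | X12 | X34 | X14 => (lam + k) / 4 | X23 => - ((lam + k) / 4)
  | _ => 0
  end.

Definition minus_coef (lam k : R) (p : axis2) : R :=
  match p with
  | X12 | X34 | X23 => - ((lam - k) / 4) | X14 => (lam - k) / 4
  | _ => 0
  end.

Definition const_coef (eps lam : R) (p : axis2) : R :=
  match p with X14 | X23 => eps * lam / 2 | _ => 0 end.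

Definition plus_square (lam c : R) (x y : R -> R) (s : R) : R :=
  ((x s + y s) / (lam * s + c)) ^ 2.

Definition minus_square (lam c : R) (x y : R -> R) (s : R) : R :=
  ((x s - y s) / (lam * s + c)) ^ 2.

Lemma spiral_e1 (I : R -> Prop) (eps lam c k : R) (x y : R -> R) :
  spiral_profile I eps lam c k x y ->
  forall t s, I s -> rotation_e1 eps x y ct t s = / (lam * s + c).
Proof.
  intros [hI heps hpos hn hx hy hk] t s hs. unfold rotation_e1.
  rewrite hn by exact hs. rewrite <- Rmult_assoc.
  replace (eps * eps) with (eps ^ 2) by ring. rewrite heps, Rmult_1_l, sqrt_pow2; auto.
  apply Rlt_le, hpos, hs.
Qed.

(** Substituting the spiral equations for [x'] and [y'] leaves a rational identity, once
    [eps] is replaced by [(y^2 - x^2) / r^2]. *)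
Lemma spiral_gauss_map (I : R -> Prop) (eps lam c k : R) (x y : R -> R) :
  spiral_profile I eps lam c k x y ->
  forall p t s, I s ->
  gauss_map (rotation_surface x y) (rotation_e1 eps x y) rotation_e2 t s p =
  gauss_t_coef eps k p * gauss_t p t +
  (plus_coef lam k p * plus_square lam c x y s +
   minus_coef lam k p * minus_square lam c x y s + const_coef eps lam p).
Proof.
  intros hsp p t s hs.
  assert (he1 := spiral_e1 I eps lam c k x y hsp t s hs).
  destruct hsp as [hI heps hpos hn hx hy hk].
  specialize (hpos s hs). specialize (hn s hs). specialize (hx s hs). specialize (hy s hs).
  assert (hp : forall j, push (rotation_surface x y) (rotation_e1 eps x y) t s j =
    / (lam * s + c) * push (rotation_surface x y) (coord_field ct) t s j).
  { intros j. unfold push, dir, coord_sum. rewrite he1. simpl. ring. }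
  assert (hC := cosh2_sinh2 t).
  unfold gauss_map, wedge, rotation_e2.
  rewrite !hp, !push_rotation_ct, !(push_rotation_cs x y t s _ _ _ hx hy).
  unfold plus_square, minus_square.
  assert (heq : eps = (y s ^ 2 - x s ^ 2) / (lam * s + c) ^ 2).
  { rewrite hn. field. lra. }
  clear hn he1 hp heps hk. subst eps.
  destruct p; simpl gauss_t; simpl gauss_t_coef; simpl plus_coef; simpl minus_coef;
    simpl const_coef; simpl fst_axis; simpl snd_axis; unfold mkvec;
    field [hC]; lra.
Qed.

(** Dividing by [r] removes the homothetic part [lam] of the spiral: [r (p / r)' = k (p / r)]. *)
Lemma is_derive_plus_square (I : R -> Prop) (eps lam c k : R) (x y : R -> R) :
  spiral_profile I eps lam c k x y -> forall s, I s ->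
  is_derive (plus_square lam c x y) s (2 * k * plus_square lam c x y s / (lam * s + c)).
Proof.
  intros [hI heps hpos hn hx hy hk] s hs.
  specialize (hpos s hs). specialize (hx s hs). specialize (hy s hs).
  unfold plus_square. derive_with hx hy; [lra|]. field. lra.
Qed.

Lemma is_derive_minus_square (I : R -> Prop) (eps lam c k : R) (x y : R -> R) :
  spiral_profile I eps lam c k x y -> forall s, I s ->
  is_derive (minus_square lam c x y) s (- 2 * k * minus_square lam c x y s / (lam * s + c)).
Proof.
  intros [hI heps hpos hn hx hy hk] s hs.
  specialize (hpos s hs). specialize (hx s hs). specialize (hy s hs).
  unfold minus_square. derive_with hx hy; [lra|]. field. lra.
Qed.

(** Both variable parts are eigenfunctions: [gauss_t'' = 4 gauss_t], while the radial part
    [B'' + (lam / r) B'] equals [(r d/ds)^2 B / r^2], and [r d/ds] multiplies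
    [Q] by [2 k] and [N] by [- 2 k]. So the Laplacian multiplies the t-part by
    [- 4 eps / r^2] and the s-part by [- 4 k^2 / r^2]; that these factors agree only if
    [k^2 = eps], that is [lam = 0], is the heart of the classification. *)
Lemma spiral_laplacian_gauss_map (I : R -> Prop) (eps lam c k : R) (x y : R -> R) :
  spiral_profile I eps lam c k x y ->
  forall p t s, I s ->
  laplacian (induced_metric (rotation_surface x y)) (rotation_e1 eps x y) rotation_e2
    (fun u v => gauss_map (rotation_surface x y) (rotation_e1 eps x y) rotation_e2 u v p) t s =
  - (4 / (lam * s + c) ^ 2) *
    (eps * gauss_t_coef eps k p * gauss_t p t +
     k ^ 2 * (plus_coef lam k p * plus_square lam c x y s +
              minus_coef lam k p * minus_square lam c x y s)).
Proof.
  intros hsp p t s hs.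
  assert (hQ := is_derive_plus_square _ _ _ _ _ _ _ hsp).
  assert (hN := is_derive_minus_square _ _ _ _ _ _ _ hsp).
  assert (hpos := spiral_pos _ _ _ _ _ _ _ hsp).
  set (Q := plus_square lam c x y) in *. set (N := minus_square lam c x y) in *.
  erewrite (warped_laplacian I eps _ _ (fun v => lam * v + c) _ _ _ (gauss_t p)
    (match p with X12 | X34 => fun u => 4 * (sinh u * cosh u)
     | _ => fun u => cosh u ^ 2 + sinh u ^ 2 end)
    (fun v => plus_coef lam k p * Q v + minus_coef lam k p * N v + const_coef eps lam p)
    (fun v => 2 * k * (plus_coef lam k p * Q v - minus_coef lam k p * N v) / (lam * v + c))
    (gauss_t_coef eps k p) (4 * gauss_t p t)
    (4 * k ^ 2 * (plus_coef lam k p * Q s + minus_coef lam k p * N s) / (lam * s + c) ^ 2 -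
     2 * k * lam * (plus_coef lam k p * Q s - minus_coef lam k p * N s) / (lam * s + c) ^ 2)
    t s (spiral_warped _ _ _ _ _ _ _ hsp)); auto.
  - specialize (hpos s hs). field. lra.
  - intros v hv. apply (spiral_norm _ _ _ _ _ _ _ hsp v hv).
  - apply (spiral_eps _ _ _ _ _ _ _ hsp).
  - intros v hv. apply Rgt_not_eq, hpos, hv.
  - intros u v hv. apply (spiral_e1 _ _ _ _ _ _ _ hsp u v hv).
  - intros u v hv. apply (spiral_gauss_map _ _ _ _ _ _ _ hsp p u v hv).
  - intros u. assert (hc := is_derive_cosh u). assert (hs' := is_derive_sinh u).
    destruct p; cbv beta iota delta [gauss_t]; derive_with hc hs'; ring.
  - assert (hc := is_derive_cosh t). assert (hs' := is_derive_sinh t).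
    destruct p; cbv beta iota delta [gauss_t]; derive_with hc hs'; ring.
  - intros v hv. assert (h1 := hQ v hv). assert (h2 := hN v hv). specialize (hpos v hv).
    derive_with h1 h2. field. lra.
  - assert (h1 := hQ s hs). assert (h2 := hN s hs). specialize (hpos s hs).
    derive_with h1 h2; [lra|]. field. lra.
Qed.

(** * Totally geodesic spiral surfaces *)

(** For [k = 0] the profile curve lies on a line through the origin and the surface in a plane.
    Conversely [II(d_s, d_t)] is [k / r] times [(x cosh t, y sinh t, y cosh t, x sinh t)],
    which does not vanish at [t = 0] because [y^2 <> x^2]. *)
Lemma spiral_totally_geodesic (I : R -> Prop) (eps lam c k : R) (x y : R -> R) :
  spiral_profile I eps lam c k x y -> (exists s, I s) ->
  totally_geodesic I (rotation_surface x y) <-> k = 0.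
Proof.
  intros hsp [s0 hs0].
  assert (hw := spiral_warped _ _ _ _ _ _ _ hsp).
  assert (hII : forall i j t s a, I s ->
    second_fundamental_form (rotation_surface x y) (coord_field i) (coord_field j) t s a =
    pd i (fun u v => push (rotation_surface x y) (coord_field j) u v a) t s -
    (warped_gamma (fun s => y s ^ 2 - x s ^ 2) (fun s => lam / (lam * s + c)) ct i j s *
       push (rotation_surface x y) (coord_field ct) t s a +
     warped_gamma (fun s => y s ^ 2 - x s ^ 2) (fun s => lam / (lam * s + c)) cs i j s *
       push (rotation_surface x y) (coord_field cs) t s a)).
  { intros i j t s a hs. unfold second_fundamental_form.
    unfold push at 2, dir, coord_sum.
    rewrite !(nabla_coord _ _ _ _ hw) by exact hs.
    unfold push, dir, coord_sum. destruct i; simpl; ring. }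
  destruct hsp as [hI heps hpos hn hx hy hk].
  split.
  - intros htg.
    assert (h1 := htg cs ct 0 s0 hs0 X1). assert (h3 := htg cs ct 0 s0 hs0 X3).
    specialize (hpos s0 hs0). specialize (hx s0 hs0). specialize (hy s0 hs0).
    specialize (hn s0 hs0).
    rewrite hII, !push_rotation_ct in h1, h3 by exact hs0. cbv beta iota delta [warped_gamma] in h1, h3.
    rewrite (pd_cs_eq I (fun u v => push (rotation_surface x y) (coord_field ct) u v X1)
      (fun v => y v * cosh 0) 0 s0 ((lam * y s0 + k * x s0) / (lam * s0 + c) * cosh 0)
      hI hs0 (fun v _ => push_rotation_ct x y 0 v X1)) in h1 by (derive_with hy hy; ring).
    rewrite (pd_cs_eq I (fun u v => push (rotation_surface x y) (coord_field ct) u v X3)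
      (fun v => x v * cosh 0) 0 s0 ((lam * x s0 + k * y s0) / (lam * s0 + c) * cosh 0)
      hI hs0 (fun v _ => push_rotation_ct x y 0 v X3)) in h3 by (derive_with hx hx; ring).
    simpl in h1, h3.
    rewrite cosh_0 in h1, h3.
    assert (h1' : k * x s0 = 0).
    { apply Rmult_eq_reg_r with (/ (lam * s0 + c)); [|apply Rinv_neq_0_compat; lra].
      rewrite Rmult_0_l, <- h1. field. lra. }
    assert (h3' : k * y s0 = 0).
    { apply Rmult_eq_reg_r with (/ (lam * s0 + c)); [|apply Rinv_neq_0_compat; lra].
      rewrite Rmult_0_l, <- h3. field. lra. }
    assert (h : k * (eps * (lam * s0 + c)) ^ 2 = 0).
    { transitivity ((y s0 * (k * y s0) - x s0 * (k * x s0)) * eps); [|rewrite h1', h3'; ring].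
      transitivity (k * (eps * (lam * s0 + c) ^ 2) * eps); [ring | rewrite <- hn; ring]. }
    apply Rmult_integral in h. destruct h as [h | h]; [exact h|].
    exfalso. rewrite Rpow_mult_distr, heps in h. nra.
  - intros -> i j t s hs a.
    assert (hl : eps = - lam ^ 2) by lra.
    assert (hp := fun u v => push_rotation_ct x y u v).
    assert (hq := fun u v (hv : I v) => fun a => push_rotation_cs x y u v _ _ a (hx v hv) (hy v hv)).
    rewrite hII, hp, hq by exact hs.
    assert (h0 := hpos s hs). assert (hxs := hx s hs). assert (hys := hy s hs).
    assert (hc := is_derive_cosh t). assert (hs' := is_derive_sinh t).
    specialize (hn s hs). rewrite hl in hn, heps.
    destruct i, j.
    + erewrite pd_ct_eq; [| intros u; apply hp |
        instantiate (1 := mkvec (y s * sinh t) (x s * cosh t) (x s * sinh t) (y s * cosh t) a);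
        destruct a; simpl; derive_with hc hs'; ring ].
      cbv beta iota delta [warped_gamma]. rewrite hn.
      destruct a; simpl mkvec; field [heps]; lra.
    + erewrite pd_ct_eq; [| intros u; apply hq, hs |
        instantiate (1 := mkvec (lam * y s / (lam * s + c) * cosh t)
          (lam * x s / (lam * s + c) * sinh t) (lam * x s / (lam * s + c) * cosh t)
          (lam * y s / (lam * s + c) * sinh t) a);
        destruct a; simpl; derive_with hc hs'; field; lra ].
      cbv beta iota delta [warped_gamma]. destruct a; simpl mkvec; field; lra.
    + erewrite pd_cs_eq; [| exact hI | exact hs | intros v hv; apply hp |
        instantiate (1 := mkvec (lam * y s / (lam * s + c) * cosh t)
          (lam * x s / (lam * s + c) * sinh t) (lam * x s / (lam * s + c) * cosh t)
          (lam * y s / (lam * s + c) * sinh t) a);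
        destruct a; simpl; derive_with hxs hys; field; lra ].
      cbv beta iota delta [warped_gamma]. destruct a; simpl mkvec; field; lra.
    + erewrite pd_cs_eq; [| exact hI | exact hs | intros v hv; apply hq, hv |
        instantiate (1 := 0);
        destruct a; simpl; derive_with hxs hys; try field; lra ].
      cbv beta iota delta [warped_gamma]. ring.
Qed.

(** * The classification *)

Lemma smooth_on_strip_const (I : R -> Prop) (a : R) : smooth_on_strip I (fun _ _ => a).
Proof.
  intros n t s _. revert a t s.
  assert (H : forall (f : R -> R -> R) (a : R), (forall u v, f u v = a) ->
    forall t s, ex_diff_n f n t s).
  { induction n as [|n IH]; intros f a hf t s.
    all: assert (hc : continuity_2d_pt f t s) by
      (apply continuity_2d_pt_ext with (fun _ _ => a);
       [intros; symmetry; auto | apply continuity_2d_pt_const]).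
    - split; [exact hc | exact Logic.I].
    - repeat split.
      + exact hc.
      + apply ex_derive_ext with (fun _ => a); [intros; symmetry; auto | apply ex_derive_const].
      + apply ex_derive_ext with (fun _ => a); [intros; symmetry; auto | apply ex_derive_const].
      + apply IH with 0. intros u v.
        rewrite (Derive_ext _ (fun _ => a)); [apply Derive_const | auto].
      + apply IH with 0. intros u v.
        rewrite (Derive_ext _ (fun _ => a)); [apply Derive_const | auto]. }
  intros a t s. apply H with a. auto.
Qed.

(** The Gauss map is then harmonic, so [f = 0] works. *)
Lemma spiral_1_type_of_k_0 (I : R -> Prop) (eps lam c : R) (x y : R -> R) :
  spiral_profile I eps lam c 0 x y ->
  pointwise_1_type_gauss_map I (rotation_surface x y) (rotation_e1 eps x y) rotation_e2.
Proof.
  intros hsp. exists (fun _ _ => 0), (fun _ => 0).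
  split; [apply smooth_on_strip_const|].
  intros t s hs p. rewrite (spiral_laplacian_gauss_map _ _ _ _ _ _ _ hsp) by exact hs.
  assert (hpos := spiral_pos _ _ _ _ _ _ _ hsp s hs).
  destruct p; simpl gauss_t_coef; field; lra.
Qed.

(** [k^2 = eps] leaves only the positive sign. *)
Lemma spiral_lam_0_eps (I : R -> Prop) (eps c k : R) (x y : R -> R) :
  spiral_profile I eps 0 c k x y -> eps = 1 /\ k ^ 2 = 1.
Proof.
  intros hsp. assert (h1 := spiral_eps _ _ _ _ _ _ _ hsp).
  assert (h2 := spiral_k _ _ _ _ _ _ _ hsp).
  assert (h3 : eps = 1) by (assert (h3 := pow2_ge_0 k); nra).
  split; [exact h3 | lra].
Qed.

(** The orbits have constant speed [c], the two eigenvalues coincide and the constant part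
    of the Gauss map vanishes: [Delta G = - (4 / c^2) G]. *)
Lemma spiral_1_type_of_lam_0 (I : R -> Prop) (eps c k : R) (x y : R -> R) :
  spiral_profile I eps 0 c k x y ->
  pointwise_1_type_gauss_map I (rotation_surface x y) (rotation_e1 eps x y) rotation_e2.
Proof.
  intros hsp. exists (fun _ _ => - (4 / c ^ 2)), (fun _ => 0).
  split; [apply smooth_on_strip_const|].
  intros t s hs p. rewrite (spiral_laplacian_gauss_map _ _ _ _ _ _ _ hsp) by exact hs.
  rewrite (spiral_gauss_map _ _ _ _ _ _ _ hsp) by exact hs.
  destruct (spiral_lam_0_eps _ _ _ _ _ _ hsp) as [-> ->].
  assert (hpos := spiral_pos _ _ _ _ _ _ _ hsp s hs).
  replace (const_coef 1 0 p) with 0 by (destruct p; simpl; field).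
  rewrite Rmult_0_l, Rplus_0_l. ring.
Qed.

(** [Q N = ((x^2 - y^2) / r^2)^2 = 1]. *)
Lemma spiral_squares_neq_0 (I : R -> Prop) (eps lam c k : R) (x y : R -> R) :
  spiral_profile I eps lam c k x y -> forall s, I s ->
  plus_square lam c x y s <> 0 /\ minus_square lam c x y s <> 0.
Proof.
  intros hsp s hs.
  assert (hpos := spiral_pos _ _ _ _ _ _ _ hsp s hs).
  assert (hn := spiral_norm _ _ _ _ _ _ _ hsp s hs).
  assert (heps := spiral_eps _ _ _ _ _ _ _ hsp).
  assert (h : plus_square lam c x y s * minus_square lam c x y s = 1).
  { unfold plus_square, minus_square.
    transitivity ((y s ^ 2 - x s ^ 2) ^ 2 / (lam * s + c) ^ 4); [field; lra|].
    rewrite hn, <- heps. field. lra. }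
  split; intros h0; rewrite h0 in h; lra.
Qed.

(** Suppose [k <> 0]. The components 13, 12 and 34 have nonzero t-parts, and they force
    [f = - 4 eps / r^2] on the line [t = 1]. Comparison with the factor [- 4 k^2 / r^2] of
    the s-parts shows that [lam^2 = k^2 - eps] times the s-part of each component is
    constant. Components 12 and 14 combine to isolate [(lam + k) Q] and [(lam - k) N], and [Q], [N]
    are not constant; so [lam^2 (lam + k) = lam^2 (lam - k) = 0], whence [lam = 0]. *)
Lemma spiral_1_type_rigid (a b : Rbar) (eps lam c k : R) (x y : R -> R) :
  Rbar_lt a b -> spiral_profile (open_itv a b) eps lam c k x y ->
  pointwise_1_type_gauss_map (open_itv a b) (rotation_surface x y)
    (rotation_e1 eps x y) rotation_e2 ->
  k = 0 \/ lam = 0.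
Proof.
  intros hab hsp (f & C & _ & hf).
  destruct (Req_dec k 0) as [hk0 | hk0]; [left; exact hk0 | right].
  set (Q := plus_square lam c x y). set (N := minus_square lam c x y).
  assert (hpos := spiral_pos _ _ _ _ _ _ _ hsp).
  assert (hk := spiral_k _ _ _ _ _ _ _ hsp).
  assert (heps := spiral_eps _ _ _ _ _ _ _ hsp).
  assert (heps0 : eps <> 0) by nra.
  assert (heq : forall t s, open_itv a b s -> forall p,
    - (4 / (lam * s + c) ^ 2) *
      (eps * gauss_t_coef eps k p * gauss_t p t +
       k ^ 2 * (plus_coef lam k p * Q s + minus_coef lam k p * N s)) =
    f t s * (gauss_t_coef eps k p * gauss_t p t +
      (plus_coef lam k p * Q s + minus_coef lam k p * N s + const_coef eps lam p) + C p)).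
  { intros t s hs p. specialize (hf t s hs p).
    rewrite (spiral_laplacian_gauss_map _ _ _ _ _ _ _ hsp) in hf by exact hs.
    rewrite (spiral_gauss_map _ _ _ _ _ _ _ hsp) in hf by exact hs. exact hf. }
  assert (hf1 : forall s, open_itv a b s -> f 1 s = - (4 * eps / (lam * s + c) ^ 2)).
  { intros s hs. assert (h0 := hpos s hs).
    (* At t = 0 the t-part of component 13 vanishes, while those of 12 and 34, nonzero and
       opposite, prevent f from vanishing. *)
    assert (hC : C X13 = 0).
    { assert (h1 := heq 0 s hs X12). assert (h2 := heq 0 s hs X34).
      assert (h3 := heq 0 s hs X13).
      cbv beta iota delta [gauss_t gauss_t_coef plus_coef minus_coef const_coef] in h1, h2, h3.
      rewrite sinh_0, cosh_0 in h1, h2, h3.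
      assert (h4 : f 0 s * (eps * k + C X12 - C X34) = - (4 / (lam * s + c) ^ 2) * k).
      { transitivity (- (4 / (lam * s + c) ^ 2) * (eps ^ 2 * k)); [lra | rewrite heps; ring]. }
      assert (h5 : f 0 s * C X13 = 0) by lra.
      apply Rmult_integral in h5. destruct h5 as [h5 | h5]; [|exact h5].
      exfalso. rewrite h5, Rmult_0_l in h4. symmetry in h4.
      apply Rmult_integral in h4. destruct h4 as [h4 | h4]; [|auto].
      assert (h6 : 0 < 4 / (lam * s + c) ^ 2) by (apply Rdiv_lt_0_compat; [lra | nra]).
      lra. }
    assert (h3 := heq 1 s hs X13).
    cbv beta iota delta [gauss_t gauss_t_coef plus_coef minus_coef const_coef] in h3.
    rewrite hC in h3.
    assert (hsh : 0 < sinh 1) by (rewrite <- sinh_0; apply sinh_lt; lra).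
    assert (hch : 0 < cosh 1) by (unfold cosh; assert (e1 := exp_pos 1);
      assert (e2 := exp_pos (- (1))); lra).
    assert (hz : eps * k * (sinh 1 * cosh 1) <> 0).
    { apply Rmult_integral_contrapositive_currified;
        apply Rmult_integral_contrapositive_currified; auto; apply Rgt_not_eq; assumption. }
    apply Rmult_eq_reg_r with (eps * k * (sinh 1 * cosh 1)); [|exact hz].
    transitivity (f 1 s * (eps * k * (sinh 1 * cosh 1) + (0 * Q s + 0 * N s + 0) + 0)); [ring|].
    rewrite <- h3. field. lra. }
  assert (hbal : forall p s, open_itv a b s ->
    f 1 s * (gauss_t_coef eps k p * gauss_t p 1 +
      (plus_coef lam k p * Q s + minus_coef lam k p * N s + const_coef eps lam p) + C p) =
    f 1 s * (gauss_t_coef eps k p * gauss_t p 1 +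
      eps * k ^ 2 * (plus_coef lam k p * Q s + minus_coef lam k p * N s))).
  { intros p s hs. rewrite <- (heq 1 s hs p), (hf1 s hs).
    transitivity (- (4 / (lam * s + c) ^ 2) *
      (eps * gauss_t_coef eps k p * gauss_t p 1 +
       eps ^ 2 * (k ^ 2 * (plus_coef lam k p * Q s + minus_coef lam k p * N s)))).
    - rewrite heps. ring.
    - assert (h0 := hpos s hs). field. lra. }
  assert (hcst : forall p s, open_itv a b s ->
    lam ^ 2 * (plus_coef lam k p * Q s + minus_coef lam k p * N s) =
    eps * (const_coef eps lam p + C p)).
  { intros p s hs. assert (h := hbal p s hs).
    apply Rmult_eq_reg_l in h.
    - replace (lam ^ 2) with (k ^ 2 - eps) by lra.
      transitivity (eps ^ 2 * k ^ 2 * (plus_coef lam k p * Q s + minus_coef lam k p * N s)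
        - eps * (plus_coef lam k p * Q s + minus_coef lam k p * N s)); [rewrite heps; ring|].
      transitivity (eps * (eps * k ^ 2 * (plus_coef lam k p * Q s + minus_coef lam k p * N s)
        - (plus_coef lam k p * Q s + minus_coef lam k p * N s))); [ring|].
      f_equal. lra.
    - rewrite (hf1 s hs). assert (h0 := hpos s hs). intros h1.
      apply heps0. apply Rmult_eq_reg_l with (- (4 / (lam * s + c) ^ 2)).
      + rewrite Rmult_0_r, <- h1. field. lra.
      + assert (h6 : 0 < 4 / (lam * s + c) ^ 2) by (apply Rdiv_lt_0_compat; [lra | nra]). lra. }
  destruct (open_itv_two_points a b hab) as (s0 & _ & hs0 & _).
  assert (hp0 := hpos s0 hs0).
  destruct (spiral_squares_neq_0 _ _ _ _ _ _ _ hsp s0 hs0) as [hQ0 hN0].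
  fold Q in hQ0. fold N in hN0.
  assert (hp : lam ^ 2 * (lam + k) = 0).
  { apply (const_multiple_zero (open_itv a b) Q s0 (2 * k * Q s0 / (lam * s0 + c)));
      [apply open_itv_open | exact hs0 |
       exact (is_derive_plus_square _ _ _ _ _ _ _ hsp s0 hs0) | | ].
    - apply Rmult_integral_contrapositive_currified; [|apply Rinv_neq_0_compat; lra].
      apply Rmult_integral_contrapositive_currified; [lra | exact hQ0].
    - intros v hv.
      assert (h1 := hcst X12 v hv). assert (h2 := hcst X14 v hv).
      assert (h3 := hcst X12 s0 hs0). assert (h4 := hcst X14 s0 hs0).
      unfold plus_coef, minus_coef in *. lra. }
  assert (hm : lam ^ 2 * (lam - k) = 0).
  { apply (const_multiple_zero (open_itv a b) N s0 (- 2 * k * N s0 / (lam * s0 + c)));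
      [apply open_itv_open | exact hs0 |
       exact (is_derive_minus_square _ _ _ _ _ _ _ hsp s0 hs0) | | ].
    - apply Rmult_integral_contrapositive_currified; [|apply Rinv_neq_0_compat; lra].
      apply Rmult_integral_contrapositive_currified; [lra | exact hN0].
    - intros v hv.
      assert (h1 := hcst X12 v hv). assert (h2 := hcst X14 v hv).
      assert (h3 := hcst X12 s0 hs0). assert (h4 := hcst X14 s0 hs0).
      unfold plus_coef, minus_coef in *. lra. }
  assert (h : lam ^ 2 * k = 0) by lra.
  apply Rmult_integral in h. destruct h as [h | h]; [nra | contradiction].
Qed.

Definition expo_diff (b0 mu1 mu2 d eps s : R) : R :=
  1 / 2 * eps * (mu2 * exp (- b0 * s + d) - mu1 * exp (- (- b0 * s + d))).

Definition expo_sum (b0 mu1 mu2 d eps s : R) : R :=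
  1 / 2 * eps * (mu2 * exp (- b0 * s + d) + mu1 * exp (- (- b0 * s + d))).

(** The null coordinates solve [p' = (k / c) p] and [m' = - (k / c) m], so they are
    exponentials with rate [- b0 = k / c], and [mu1 mu2 = p m = - c^2] with [k^2 = 1]. *)
Lemma spiral_lam_0_exp (a b : Rbar) (eps c k : R) (x y : R -> R) :
  Rbar_lt a b -> spiral_profile (open_itv a b) eps 0 c k x y ->
  exists b0 mu1 mu2, b0 <> 0 /\ mu1 * mu2 = - (1 / b0 ^ 2) /\
    forall s, open_itv a b s ->
      y s = expo_diff b0 mu1 mu2 0 1 s /\ x s = expo_sum b0 mu1 mu2 0 1 s.
Proof.
  intros hab hsp.
  destruct (open_itv_two_points a b hab) as (s0 & _ & hs0 & _).
  destruct (spiral_lam_0_eps _ _ _ _ _ _ hsp) as [he hk].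
  destruct hsp as [hI heps hpos hn hx hy _].
  assert (hc := hpos s0 hs0). rewrite Rmult_0_l, Rplus_0_l in hc.
  set (b0 := - (k / c)).
  set (mp := fun s => (x s + y s) * exp (b0 * s)).
  set (mm := fun s => (x s - y s) * exp (- b0 * s)).
  assert (hmp : forall s, open_itv a b s -> mp s = mp s0).
  { intros s hs. apply (const_of_derive_zero a b mp); auto. intros v hv.
    assert (h1 := hx v hv). assert (h2 := hy v hv). rewrite Rmult_0_l, Rplus_0_l in h1, h2.
    unfold mp. derive_with h1 h2. unfold b0. field. lra. }
  assert (hmm : forall s, open_itv a b s -> mm s = mm s0).
  { intros s hs. apply (const_of_derive_zero a b mm); auto. intros v hv.
    assert (h1 := hx v hv). assert (h2 := hy v hv). rewrite Rmult_0_l, Rplus_0_l in h1, h2.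
    unfold mm. derive_with h1 h2. unfold b0. field. lra. }
  assert (hexp : forall s, exp (b0 * s) * exp (- b0 * s) = 1).
  { intros s. rewrite <- exp_plus. replace (b0 * s + - b0 * s) with 0 by ring. apply exp_0. }
  exists b0, (mm s0), (mp s0). split; [|split].
  - unfold b0. intros h. assert (h1 : k = 0); [|rewrite h1 in hk; lra].
    transitivity (- (- (k / c)) * c); [field; lra | rewrite h; ring].
  - transitivity (- (y s0 ^ 2 - x s0 ^ 2)).
    + unfold mm, mp.
      transitivity ((x s0 ^ 2 - y s0 ^ 2) * (exp (b0 * s0) * exp (- b0 * s0))); [ring|].
      rewrite hexp. ring.
    + rewrite hn, he by exact hs0. unfold b0.
      assert (hk0 : k <> 0) by (intros h; rewrite h in hk; lra).
      transitivity (- (c ^ 2 / k ^ 2)); [rewrite hk; field | field; lra].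
  - intros s hs. rewrite <- (hmp s hs), <- (hmm s hs).
    unfold expo_diff, expo_sum, mp, mm.
    replace (- b0 * s + 0) with (- b0 * s) by ring.
    replace (- (- b0 * s)) with (b0 * s) by ring.
    assert (h := hexp s).
    split; field_simplify_eq; ring [h].
Qed.

(** In the exponential parametrization [y^2 - x^2 = - mu1 mu2] is constant, hence so is
    [r = lam s + c]. *)
Lemma spiral_exp_lam_0 (a b : Rbar) (eps lam c k b0 mu1 mu2 d e : R) (x y : R -> R) :
  Rbar_lt a b -> spiral_profile (open_itv a b) eps lam c k x y ->
  e ^ 2 = 1 ->
  (forall s, open_itv a b s ->
     y s = expo_diff b0 mu1 mu2 d e s /\ x s = expo_sum b0 mu1 mu2 d e s) ->
  lam = 0.
Proof.
  intros hab hsp he hxy.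
  destruct (open_itv_two_points a b hab) as (s1 & s2 & h1 & h2 & h12).
  assert (hW : forall s, open_itv a b s -> eps * (lam * s + c) ^ 2 = - (mu1 * mu2)).
  { intros s hs. rewrite <- (spiral_norm _ _ _ _ _ _ _ hsp s hs).
    destruct (hxy s hs) as [-> ->]. unfold expo_diff, expo_sum.
    assert (hexp : exp (- b0 * s + d) * exp (- (- b0 * s + d)) = 1)
      by (rewrite <- exp_plus, Rplus_opp_r; apply exp_0).
    transitivity (- (e ^ 2 * (mu1 * mu2) *
      (exp (- b0 * s + d) * exp (- (- b0 * s + d))))); [field|].
    rewrite he, hexp. ring. }
  assert (hpos := spiral_pos _ _ _ _ _ _ _ hsp).
  assert (heps := spiral_eps _ _ _ _ _ _ _ hsp).
  assert (p1 := hpos s1 h1). assert (p2 := hpos s2 h2).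
  assert (w1 := hW s1 h1). rewrite <- (hW s2 h2) in w1.
  apply Rmult_eq_reg_l in w1; [|intros h; rewrite h in heps; lra].
  assert (h : lam * s1 + c = lam * s2 + c) by nra.
  assert (h' : lam * (s2 - s1) = 0) by lra.
  apply Rmult_integral in h'. destruct h' as [h' | h']; [exact h' | lra].
Qed.

Theorem theorem1 (a b : Rbar) (hab : Rbar_lt a b)
  (eps1 : R) (heps1 : eps1 = 1 \/ eps1 = -1)
  (x y : R -> R)
  (hx : smooth_on (open_itv a b) x)
  (hy : smooth_on (open_itv a b) y)
  (hunit : forall s, open_itv a b s -> Derive x s ^ 2 - Derive y s ^ 2 = 1)
  (hpos : forall s, open_itv a b s -> eps1 * (y s ^ 2 - x s ^ 2) > 0)
  (hflat : flat (open_itv a b) (rotation_surface x y)) :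
  pointwise_1_type_gauss_map (open_itv a b) (rotation_surface x y)
    (rotation_e1 eps1 x y) rotation_e2
  <->
  (totally_geodesic (open_itv a b) (rotation_surface x y) \/
   exists b0 mu1 mu2 d eps : R,
     b0 <> 0 /\ (eps = 1 \/ eps = -1) /\ mu1 * mu2 = - (1 / b0 ^ 2) /\
     forall t s : R, open_itv a b s ->
       rotation_surface x y t s =
       mkvec
         (1 / 2 * eps *
            (mu2 * exp (- b0 * s + d) - mu1 * exp (- (- b0 * s + d))) * sinh t)
         (1 / 2 * eps *
            (mu2 * exp (- b0 * s + d) + mu1 * exp (- (- b0 * s + d))) * cosh t)
         (1 / 2 * eps *
            (mu2 * exp (- b0 * s + d) + mu1 * exp (- (- b0 * s + d))) * sinh t)
         (1 / 2 * eps *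
            (mu2 * exp (- b0 * s + d) - mu1 * exp (- (- b0 * s + d))) * cosh t)).
Proof.
  assert (heps : eps1 ^ 2 = 1) by (destruct heps1 as [-> | ->]; ring).
  destruct (flat_rotation_spiral a b eps1 x y hab heps hx hy hunit hpos hflat)
    as (lam & c & k & hsp).
  assert (hne : exists s, open_itv a b s).
  { destruct (open_itv_two_points a b hab) as (s & _ & hs & _). exists s. exact hs. }
  assert (htg := spiral_totally_geodesic _ _ _ _ _ _ _ hsp hne).
  split.
  - intros h1. destruct (spiral_1_type_rigid _ _ _ _ _ _ _ _ hab hsp h1) as [hk | hlam].
    + left. apply htg, hk.
    + right. subst lam.
      destruct (spiral_lam_0_exp _ _ _ _ _ _ _ hab hsp) as (b0 & mu1 & mu2 & hb & hmu & hxy).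
      exists b0, mu1, mu2, 0, 1. repeat split; auto.
      intros t s hs. unfold rotation_surface.
      destruct (hxy s hs) as [-> ->]. reflexivity.
  - intros [h | (b0 & mu1 & mu2 & d & e & _ & he & _ & hphi)].
    + apply htg in h. subst k. apply spiral_1_type_of_k_0 with lam c, hsp.
    + assert (hlam : lam = 0).
      { apply (spiral_exp_lam_0 a b eps1 lam c k b0 mu1 mu2 d e x y hab hsp).
        - destruct he as [-> | ->]; ring.
        - intros s hs. assert (h := hphi 0 s hs).
          assert (h2 := f_equal (fun v : vec => v X2) h).
          assert (h4 := f_equal (fun v : vec => v X4) h).
          cbv beta iota delta [rotation_surface mkvec] in h2, h4.
          rewrite cosh_0, !Rmult_1_r in h2, h4. split; assumption. }
      subst lam. apply spiral_1_type_of_lam_0 with c k, hsp.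
Qed.
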